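(* For $a\in(0,1)$ define $$g^{(a)}(n)=\begin{cases}\sqrt{n\log n}, & a\le\tfrac12,\\ n^a, & a>\tfrac12.\end{cases}$$ Let $x>0$. For every finite alphabet $\mathcal{A}$ with $|\mathcal{A}|\ge2$ there exists a constant $C_2(x,|\mathcal{A}|)$, depending only on $x$ and $|\mathcal{A}|$, such that for every $a\in(0,1)$ $$\varlimsup_{n\to\infty}\frac{\mathbb{E}\bigl[R^{(\mathrm{al})}_{\lfloor|\mathcal{A}|n-xn^a\rfloor,n}\bigr]}{(g^{(a)}(n))^{2/3}}\le C_2(x,|\mathcal{A}|),$$ and these constants satisfy $C_2(x,|\mathcal{A}|)\to0$ as $|\mathcal{A}|\to\infty$.
   Context: Alignment model: $\eta^{\mathrm{x}}=\eta^{\mathrm{x}}_1\eta^{\mathrm{x}}_2\cdots$ and $\eta^{\mathrm{y}}=\eta^{\mathrm{y}}_1\eta^{\mathrm{y}}_2\cdots$ are two independent infinite words whose letters are chosen independently and uniformly at random from $\mathcal{A}$; their joint law is $\mathbb{P}$, with expectation $\mathbb{E}$. The environment is $\omega_{i,j}=1$ if $\eta^{\mathrm{x}}_i=\eta^{\mathrm{y}}_j$ and $\omega_{i,j}=0$ otherwise ($i,j\ge1$). An admissible path from $(0,0)$ to $(m,n)$ is a lattice path whose increments all lie in $\{e_1,e_2,e_1+e_2\}$. For an admissible path $\pi$, a match is a step $e_1+e_2$ whose endpoint $(i,j)$ has $\omega_{i,j}=1$, a mismatch is a step $e_1+e_2$ whose endpoint has $\omega_{i,j}=0$, and a gap is a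 step $e_1$ or $e_2$. Let $x(\pi),y(\pi),z(\pi)$ be the numbers of mismatches, gaps and matches of $\pi$. Optimality regions (with mismatch penalty $\alpha=0$): for a gap penalty $\beta\ge 0$ the score of $\pi$ is $z(\pi)-\beta y(\pi)$. Let $\Gamma^{(\beta)}_{0,(m,n)}$ be the set of minimal-gap maximisers, i.e. the paths from $(0,0)$ to $(m,n)$ that maximise the score and, among the maximisers, have the smallest number of gaps. Two penalties $\beta,\beta'$ lie in different optimality regions iff $\Gamma^{(\beta)}_{0,(m,n)}\cap\Gamma^{(\beta')}_{0,(m,n)}=\varnothing$. The critical penalties $0<\beta_1<\dots<\beta_{R}<\infty$ are the values of $\beta>0$ at which the optimality region changes as $\beta$ increases, and $R=R^{(\mathrm{al})}_{m,n}$ is the number of these critical penalties. *)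

(* Defs.v *)
From HB Require Import structures.
From mathcomp Require Import all_boot all_order all_algebra finmap.
From mathcomp Require Import all_classical all_reals all_analysis.
From mathcomp Require Import lra zify.

Set Implicit Arguments.
Unset Strict Implicit.
Unset Printing Implicit Defensive.

Import Order.TTheory GRing.Theory Num.Theory.
Import numFieldNormedType.Exports.

Local Open Scope classical_set_scope.
Local Open Scope ring_scope.

Definition point := (nat * nat)%type.

Definition diagonal (p q : point) : bool := q == (p.1.+1, p.2.+1).

Definition straight (p q : point) : bool :=
  (q == (p.1.+1, p.2)) || (q == (p.1, p.2.+1)).

(* A path from (0,0) is the list of its vertices other than (0,0). *)
Definition admissible (m n : nat) (pi : seq point) : bool :=
  path (fun p q => diagonal p q || straight p q) (0, 0)%N pi
  && (last (0, 0)%N pi == (m, n)).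

Definition steps (pi : seq point) : seq (point * point) :=
  zip ((0, 0)%N :: pi) pi.

Definition gaps (pi : seq point) : nat :=
  count (fun e => straight e.1 e.2) (steps pi).

Section Alignment.
Context {A : finType}.

(* Words are indexed from 0 ([wx i] is the letter of rank i+1), while the
   environment is only read at i, j >= 1. *)
Definition env (wx wy : nat -> A) (i j : nat) : bool := wx i.-1 == wy j.-1.

Definition matches (wx wy : nat -> A) (pi : seq point) : nat :=
  count (fun e => diagonal e.1 e.2 && env wx wy e.2.1 e.2.2) (steps pi).

Context {R : realType}.

Definition score (wx wy : nat -> A) (beta : R) (pi : seq point) : R :=
  (matches wx wy pi)%:R - beta * (gaps pi)%:R.

Definition maximisers (wx wy : nat -> A) (m n : nat) (beta : R) :
    set (seq point) :=
  [set pi | admissible m n pi /\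
    forall pi', admissible m n pi' ->
      score wx wy beta pi' <= score wx wy beta pi].

Definition min_gap_maximisers (wx wy : nat -> A) (m n : nat) (beta : R) :
    set (seq point) :=
  [set pi | maximisers wx wy m n beta pi /\
    forall pi', maximisers wx wy m n beta pi' -> (gaps pi <= gaps pi')%N].

Definition different_regions (wx wy : nat -> A) (m n : nat) (b b' : R) : Prop :=
  min_gap_maximisers wx wy m n b `&` min_gap_maximisers wx wy m n b' = set0.

(* The region changes at beta: every neighbourhood of beta contains two
   nonnegative penalties lying in different regions. *)
Definition critical_penalties (wx wy : nat -> A) (m n : nat) : set R :=
  [set beta | 0 < beta /\
    forall e : R, 0 < e -> exists b b' : R,
      [/\ 0 <= b, 0 <= b', `|b - beta| < e, `|b' - beta| < e
        & different_regions wx wy m n b b']].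

End Alignment.

(* [fset_set] is only meaningful on finite sets; see
   [finite_critical_penalties] below. *)
Definition num_critical (R : realType) (A : finType) (wx wy : nat -> A)
    (m n : nat) : nat :=
  #|` fset_set (critical_penalties wx wy m n : set R) |%fset.

Definition mutually_independent d (T : measurableType d) (R : realType)
    (P : probability T R) (I : eqType) (A : Type) (Z : I -> T -> A) : Prop :=
  forall (s : seq I) (B : I -> set A), uniq s ->
    P (\bigcap_(i in [set` s]) Z i @^-1` B i)
    = (\prod_(i <- s) P (Z i @^-1` B i))%E.

(* Two independent words of i.i.d. uniform letters; A carries the discrete
   sigma-algebra. *)
Definition independent_uniform_words d (T : measurableType d) (R : realType)
    (P : probability T R) (A : finType) (etax etay : nat -> T -> A) : Prop :=
  let Z (i : nat + nat) := match i with inl k => etax k | inr k => etay k end in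
  [/\ forall i (B : set A), measurable (Z i @^-1` B),
      forall i (c : A), P (Z i @^-1` [set c]) = ((#|A|%:R)^-1)%:E
    & mutually_independent P Z].

Definition growth (R : realType) (a : R) (n : nat) : R :=
  if a <= 2^-1 then Num.sqrt (n%:R * ln n%:R) else n%:R `^ a.

(* [Num.truncn] is the floor on nonnegative reals (and 0 on negative ones, a
   case which only arises for finitely many n). *)
Definition long_side (R : realType) (k : nat) (x a : R) (n : nat) : nat :=
  Num.truncn (k%:R * n%:R - x * n%:R `^ a).

Section Finiteness.
Context {A : finType} {R : realType} (wx wy : nat -> A) (m n : nat).

Lemma admissible_exists : exists pi, admissible m n pi.
Proof.
rewrite /admissible; elim: n => [|k [pi /andP[pP /eqP pl]]]; last first.
  exists (rcons pi (m, k.+1)); rewrite rcons_path last_rcons pP pl eqxx.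
  by rewrite /straight /= eqxx !orbT.
elim: m => [|k [pi /andP[pP /eqP pl]]]; first by exists [::].
exists (rcons pi (k.+1, 0%N)); rewrite rcons_path last_rcons pP pl eqxx.
by rewrite /straight /= eqxx !orbT.
Qed.

Lemma admissible_size pi : admissible m n pi -> (size pi <= m + n)%N.
Proof.
rewrite /admissible => /andP[pP /eqP pl].
suff H p : path (fun p q => diagonal p q || straight p q) p pi ->
    (p.1 + p.2 + size pi <= (last p pi).1 + (last p pi).2)%N.
  by have := H _ pP; rewrite pl.
elim: pi p {pP pl} => [|q pi IH] p /=; first by rewrite addn0.
case/andP => pq /IH; apply: leq_trans.
by case/orP: pq => [/eqP ->|/orP[]/eqP ->] /=; lia.
Qed.

Let size_steps pi : size (steps pi) = size pi.
Proof. by rewrite size_zip /=; lia. Qed.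

Lemma gaps_le pi : admissible m n pi -> (gaps pi < (m + n).+1)%N.
Proof.
by move=> /admissible_size h; rewrite ltnS (leq_trans _ h)// -size_steps count_size.
Qed.

Lemma matches_le pi : admissible m n pi -> (matches wx wy pi < (m + n).+1)%N.
Proof.
by move=> /admissible_size h; rewrite ltnS (leq_trans _ h)// -size_steps count_size.
Qed.

Lemma min_gap_maximisers_neq0 (b : R) :
  exists pi, min_gap_maximisers wx wy m n b pi.
Proof.
pose N := (m + n).+1.
pose Q (ij : 'I_N * 'I_N) := `[< exists pi, [/\ admissible m n pi,
  matches wx wy pi = ij.1 & gaps pi = ij.2] >].
pose F (ij : 'I_N * 'I_N) : R := ij.1%:R - b * ij.2%:R.
have inQ pi (h : admissible m n pi) :
    Q (Ordinal (matches_le h), Ordinal (gaps_le h)).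
  by apply/asboolP; exists pi.
have [p0 h0] := admissible_exists.
have [ij /asboolP[pi [hpi mpi gpi]] ijmax] := arg_maxP F (inQ _ h0).
have piM : maximisers wx wy m n b pi.
  split=> // pi' h'; have := ijmax _ (inQ _ h').
  by rewrite /F /= /score mpi gpi.
have ex : exists k, `[< exists2 p, maximisers wx wy m n b p & gaps p = k >].
  by exists (gaps pi); apply/asboolP; exists pi.
case: (ex_minnP ex) => k /asboolP[p pM <-] kmin.
exists p; split=> // p' p'M; apply: kmin; apply/asboolP; by exists p'.
Qed.

Lemma finite_critical_penalties :
  finite_set (critical_penalties wx wy m n : set R).
Proof.
pose N := (m + n).+1.
pose f (t : ('I_N * 'I_N) * ('I_N * 'I_N)) : R :=
  (t.1.1%:R - t.1.2%:R) / (t.2.1%:R - t.2.2%:R).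
have finS : finite_set (range f) by apply: finite_image; exact: finite_finset.
apply: (sub_finite_set _ finS) => beta [beta0 Hc]; apply: contrapT => nS.
have : nbhs beta (~` range f).
  apply: open_nbhs_nbhs; split => //; apply: closed_openC.
  have /accessible_finite_set_closed := hausdorff_accessible (@Rhausdorff R).
  by apply.
rewrite -nbhs_ballE => -[e /= e0 eS].
suff same (b b' : R) : b <= b' -> `|b - beta| < e -> `|b' - beta| < e ->
    ~ different_regions wx wy m n b b'.
  have [b [b' [_ _ be b'e]]] := Hc e e0.
  have [bb'|/ltW b'b] := leP b b'; first exact: same.
  by rewrite /different_regions setIC; exact: same.
move=> bb' be b'e.
(* no score comparison changes sign on [b, b'] *)
have noroot p p' (t : R) : admissible m n p -> admissible m n p' ->
    b <= t <= b' -> score wx wy t p = score wx wy t p' -> gaps p = gaps p'.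
  move=> hp hp' /andP[bt tb'] E; apply: contrapT => ng.
  have te : ball beta e t.
    rewrite -ball_normE /= distrC; move: be b'e; rewrite !ltr_norml.
    by move=> /andP[? ?] /andP[? ?]; apply/andP; split; lra.
  apply: (eS _ te).
  exists (Ordinal (matches_le hp), Ordinal (matches_le hp'),
          (Ordinal (gaps_le hp), Ordinal (gaps_le hp'))) => //.
  have ng0 : (gaps p)%:R - (gaps p')%:R != 0 :> R.
    by rewrite subr_eq0 eqr_nat; apply/eqP.
  rewrite /f /=; apply: (mulIf ng0); rewrite divfK//.
  by move: E; rewrite /score; lra.
have [p [[hp pmax] pmin]] := min_gap_maximisers_neq0 b.
suff key p' : admissible m n p' -> score wx wy b' p' <= score wx wy b' p /\
    (score wx wy b' p' = score wx wy b' p -> gaps p = gaps p').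
  rewrite /different_regions => /seteqP[sub _]; apply: (sub p); split=> //.
  split; first by split=> // p' /key[].
  move=> p' [hp' p'max]; have [le eqg] := key _ hp'.
  by rewrite eqg //; apply: le_anti; rewrite le p'max.
move=> hp'; split; last first.
  by move=> E; apply: (noroot _ _ b') => //; rewrite bb' /=.
rewrite leNgt; apply/negP => lt'.
have le := pmax _ hp'.
pose u : R := score wx wy b p - score wx wy b p'.
pose v : R := score wx wy b' p' - score wx wy b' p.
have u0 : 0 <= u by rewrite subr_ge0.
have v0 : 0 < v by rewrite subr_gt0.
have uv0 : 0 < u + v by lra.
pose s := u / (u + v).
have s01 : 0 <= s <= 1.
  by rewrite divr_ge0 ?(ltW uv0)//= ler_pdivrMr// mul1r; lra.
have sE : s * (u + v) = u by rewrite divfK// gt_eqF.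
have g : gaps p = gaps p'.
  apply: (noroot _ _ (b + s * (b' - b))) => //.
    by case/andP: s01 => ? ?; apply/andP; split; nra.
  by move: sE; rewrite /u /v /score; nra.
by move: le lt'; rewrite /score g !lerD2r !ltrD2r; lra.
Qed.

End Finiteness.

(* Main.v *)
Require Import Defs.
From mathcomp Require Import all_boot all_order all_algebra finmap.
From mathcomp Require Import all_classical all_reals all_analysis.
From mathcomp Require Import measurable_realfun ring lra zify.
Import Order.TTheory GRing.Theory Num.Theory.
Import numFieldNormedType.Exports.
Local Open Scope classical_set_scope.
Local Open Scope ring_scope.
(* [point], [diagonal] and [steps] below are those of alignment paths. *)
Import Defs.

Set Implicit Arguments.
Unset Strict Implicit.

(** Write k for the size of the alphabet, m for the length of the long word and
    n for that of the short one.

    Each critical penalty b has two maximisers with different numbers of gaps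
    ([critical_two_maximisers]); let dg be the excess of gaps and dm the excess
    of matches of one over the other, so that dm = b dg. Since the slope of
    (dg, dm) is b, distinct critical penalties have distinct integer vectors
    (dg, dm). On the other hand gaps and matches of maximisers cannot increase with
    the penalty, so these vectors are edges of a monotone staircase and their
    total length is at most the size of the box that contains all maximisers.
    Only u^2 vectors have both coordinates below u, and each of the others uses
    up at least u of the total length: a box of size 3M leaves room for at most
    u^2 + 3M/u critical penalties, whatever u ([num_critical_le]).

    The box is small as soon as one path without vertical step has few
    mismatches: a path with m - n gaps and at least n - M matches forces every
    maximiser to have between n - M and n matches, and between m - n and
    m - n + 2M gaps. Such a path comes from the greedy matching, which reads the
    long word and matches the next letter of the short word whenever it can,
    and which gives up when r letters of the long word are left; it provides
    M = r as soon as n - r letters have been matched by then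
    ([path_few_mismatches]).

    For a fixed short word, the number of letters matched greedily after i
    letters of the long word is binomial with parameters i and 1/k. Its mean and
    variance and Chebyshev's inequality bound the probability that r does not
    suffice by 8n/r^2 once r exceeds about 4 x n^a / k. Summing over r, the mean
    of M is at most of order 4 x n^a / k + 9 sqrt n ([mean_late_matches]). The
    term sqrt n is negligible with respect to g(n), so the choice
    u ~ (g(n) / k)^(1/3) bounds the limit superior by (5 + 12 x) k^(-2/3), which
    vanishes as k grows.

    The expectations are averages over finite words, because the number of
    critical penalties depends only on the first m and n letters
    ([expectation_words]). *)

(** * Counting integer vectors *)

(** Each of the N unit intervals starting at b + t is covered at most once. *)
Lemma sum_disjoint_intervals (I : eqType) (s : seq I) (lo hi : I -> nat)
    (b N : nat) :
  uniq s ->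
  (forall i, i \in s -> (b <= lo i)%N && (hi i <= b + N)%N) ->
  (forall i j, i \in s -> j \in s -> i != j ->
    (hi i <= lo j)%N || (hi j <= lo i)%N) ->
  (\sum_(i <- s) (hi i - lo i) <= N)%N.
Proof.
move=> us range disj.
have len i : i \in s ->
    (hi i - lo i = \sum_(t < N) (lo i <= b + t < hi i))%N.
  move=> /range /andP[bl hN].
  rewrite -[in LHS](minn_idPl hN); elim: (N) => [|k IH].
    by rewrite big_ord0; lia.
  by rewrite big_ord_recr /= -IH; lia.
rewrite big_seq (eq_bigr _ len) -big_seq exchange_big /=.
rewrite -[leqRHS]card_ord -sum1_card leq_sum// => t _.
elim: s us range disj {len} => [|i s IH]; first by rewrite big_nil.
rewrite cons_uniq => /andP[is_ us] range disj; rewrite big_cons.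
have range' j : j \in s -> (b <= lo j)%N && (hi j <= b + N)%N.
  by move=> js; apply: range; rewrite inE js orbT.
have disj' j j' : j \in s -> j' \in s -> j != j' ->
    (hi j <= lo j')%N || (hi j' <= lo j)%N.
  by move=> js j's; apply: disj; rewrite inE ?js ?j's orbT.
have [tin|_] := boolP (lo i <= b + t < hi i)%N; last exact: IH.
rewrite big_seq big1// => j js.
have ij : i != j by apply: contraNneq is_ => ->.
have := disj i j (mem_head _ _) _ ij; rewrite inE js orbT => /(_ isT).
by move: tin; case: (lo j <= b + t < hi j)%N / boolP; lia.
Qed.

(** At most u^2 of the vectors have both coordinates below u, and each of the
    others contributes at least u to the sum. Optimising over u, this is how a
    total length L bounds the number of distinct vectors by O(L^(2/3)); keeping
    u free makes the bound linear in L, hence compatible with expectations. *)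
Lemma size_distinct_pairs (I : eqType) (s : seq I) (d e : I -> nat) (u : nat) :
  uniq s -> {in s &, injective (fun i => (d i, e i))} ->
  (u * size s <= u ^ 3 + \sum_(i <- s) (d i + e i))%N.
Proof.
move=> us inj.
pose short i := ((d i < u) && (e i < u))%N.
have short_le : (count short s <= u ^ 2)%N.
  rewrite -size_filter -(size_map (fun i => (d i, e i))) -mulnn.
  have -> : (u * u = size [seq (i, j) | i <- iota 0 u, j <- iota 0 u])%N.
    by rewrite size_allpairs size_iota.
  apply: uniq_leq_size.
    rewrite map_inj_in_uniq ?filter_uniq// => i j.
    by rewrite !mem_filter => /andP[_ ?] /andP[_ ?]; exact: inj.
  move=> p /mapP[i]; rewrite mem_filter => /andP[/andP[di ei] _ ->].
  by apply: allpairs_f; rewrite mem_iota.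
have long_le : (u * count (predC short) s <= \sum_(i <- s) (d i + e i))%N.
  elim: s {us inj short_le} => [|i s IH]; first by rewrite muln0.
  rewrite big_cons /= mulnDr leq_add//.
  by rewrite /short; case: ltnP => ?; case: ltnP => ? /=; lia.
rewrite -(count_predC short) mulnDr leq_add//.
by rewrite expnS leq_mul2l short_le orbT.
Qed.

(** * Paths and the greedy matching *)

Lemma steps_rcons (pi : seq point) (q : point) :
  steps (rcons pi q) = rcons (steps pi) (last (0, 0)%N pi, q).
Proof.
rewrite /steps; elim: pi (0, 0)%N => [|p pi IH] p0 //=.
by rewrite /= in IH; rewrite IH.
Qed.

Lemma gaps_rcons (pi : seq point) (q : point) :
  gaps (rcons pi q) = (gaps pi + straight (last (0, 0)%N pi) q)%N.
Proof. by rewrite /gaps steps_rcons -cats1 count_cat /= addn0. Qed.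

Lemma admissible_rcons (m n m' n' : nat) (pi : seq point) :
  admissible m n pi -> diagonal (m, n) (m', n') || straight (m, n) (m', n') ->
  admissible m' n' (rcons pi (m', n')).
Proof.
by rewrite /admissible rcons_path last_rcons eqxx => /andP[-> /eqP ->] ->.
Qed.

Section Paths.
Context {A : finType} (wx wy : nat -> A).

Lemma matches_rcons (pi : seq point) (q : point) :
  matches wx wy (rcons pi q) = (matches wx wy pi +
    (diagonal (last (0, 0)%N pi) q && env wx wy q.1 q.2))%N.
Proof. by rewrite /matches steps_rcons -cats1 count_cat /= addn0. Qed.

(** Gaps make up for the difference of lengths, each match uses a letter of the
    second word, and a gap uses one of the m + n letters where a match uses
    two. *)
Lemma admissible_counts (m n : nat) (pi : seq point) : admissible m n pi ->
  [/\ (m <= n + gaps pi)%N, (matches wx wy pi <= n)%N &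
      (gaps pi + 2 * matches wx wy pi <= m + n)%N].
Proof.
elim/last_ind: pi m n => [|pi q IH] m n.
  by rewrite /admissible /= => /eqP[<- <-].
rewrite /admissible rcons_path last_rcons => /andP[/andP[pP lq] /eqP qE].
rewrite gaps_rcons matches_rcons; move: lq; rewrite {}qE {q}.
case lE : (last _ _) => [i j].
have := IH i j; rewrite /admissible pP lE eqxx => /(_ isT).
rewrite /straight /diagonal !xpair_eqE /=.
by case: env => -[? ? ?] ?; split; lia.
Qed.

(** The number of letters of wy matched after reading i letters of wx, when each
    letter of wx that equals the first unmatched letter of wy is matched to it.
    Waiting for matches keeps the next comparison independent of the past,
    which makes this count binomial for uniform words. *)
Fixpoint greedy (i : nat) : nat :=
  if i is i'.+1 then (greedy i' + (wx i' == wy (greedy i')))%N else 0%N.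

Lemma greedy_ivt (i c : nat) :
  (c <= greedy i)%N -> exists2 j, (j <= i)%N & greedy j = c.
Proof.
elim: i => [|i IH] /=; first by rewrite leqn0 => /eqP ->; exists 0%N.
rewrite leq_eqVlt => /orP[/eqP ->|lt]; first by exists i.+1.
have [|j ji jc] := IH; first by move: lt; rewrite /=; case: (wx i == _); lia.
by exists j => //; exact: leqW.
Qed.

Lemma greedy_path (i : nat) : (greedy i <= i)%N /\ exists pi,
  [/\ admissible i (greedy i) pi, gaps pi = (i - greedy i)%N
    & matches wx wy pi = greedy i].
Proof.
elim: i => [|i [le [pi [piA pig pim]]]].
  by split=> //; exists [::]; rewrite /admissible /gaps /matches.
split; first by rewrite /=; case: (wx i == _); lia.
have /andP[_ /eqP lE] := piA.
exists (rcons pi (i.+1, greedy i.+1)).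
rewrite gaps_rcons matches_rcons lE pig pim /=; split.
- apply: admissible_rcons piA _.
  by rewrite /diagonal /straight !xpair_eqE /=; case: (wx i == _); lia.
- by rewrite /straight !xpair_eqE /=; case: (wx i == _); lia.
- rewrite /diagonal /env !xpair_eqE /= eqxx.
  case wE: (wx i == wy (greedy i)); last by lia.
  by rewrite addn1 eqxx /= wE addn1.
Qed.

Lemma extend_diagonal (m n r : nat) (pi : seq point) : admissible m n pi ->
  exists pi', [/\ admissible (m + r) (n + r) pi', gaps pi' = gaps pi
    & (matches wx wy pi <= matches wx wy pi')%N].
Proof.
move=> piA; elim: r => [|r [pi' [pA pg pm]]]; first by exists pi; rewrite !addn0.
have /andP[_ /eqP lE] := pA.
exists (rcons pi' ((m + r).+1, (n + r).+1)%N).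
rewrite !addnS gaps_rcons matches_rcons lE pg; split; last exact: leq_trans (leq_addr _ _).
- by apply: admissible_rcons pA _; rewrite /diagonal eqxx.
- by rewrite /straight !xpair_eqE /=; lia.
Qed.

Lemma extend_horizontal (m n r : nat) (pi : seq point) : admissible m n pi ->
  exists pi', [/\ admissible (m + r) n pi', gaps pi' = (gaps pi + r)%N
    & (matches wx wy pi <= matches wx wy pi')%N].
Proof.
move=> piA; elim: r => [|r [pi' [pA pg pm]]]; first by exists pi; rewrite !addn0.
have /andP[_ /eqP lE] := pA.
exists (rcons pi' ((m + r).+1, n)%N).
rewrite !addnS gaps_rcons matches_rcons lE pg; split; last exact: leq_trans (leq_addr _ _).
- by apply: admissible_rcons pA _; rewrite /straight eqxx orbT.
- by rewrite /straight !xpair_eqE /= !eqxx addn1.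
Qed.

(** Follow the greedy matching until exactly n - r letters of wy are matched,
    which happens early enough for r letters of wx to remain; align the r
    remaining letters of wy diagonally, whether they match or not, and finish
    horizontally. No step is vertical, so the gaps are as few as possible. *)
Lemma path_few_mismatches (m n r : nat) : (r <= n)%N -> (n <= m)%N ->
  (n - r <= greedy (m - r))%N ->
  exists pi, [/\ admissible m n pi, gaps pi = (m - n)%N
    & (n - r <= matches wx wy pi)%N].
Proof.
move=> rn nm /greedy_ivt[i im iE].
have [le [pi [piA pig pim]]] := greedy_path i; rewrite iE in le piA pig pim.
have [pi1 [p1A p1g p1m]] := extend_diagonal r piA.
have [pi2 [p2A p2g p2m]] := extend_horizontal (m - r - i) p1A.
exists pi2; split; last by rewrite -pim (leq_trans p1m).
- by move: p2A; congr (admissible _ _ _); lia.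
- by rewrite p2g p1g pig; lia.
Qed.

End Paths.

(** * Critical penalties and edges of the optimal staircase *)

Section CriticalPenalties.
Context {A : finType} {R : realType} (wx wy : nat -> A) (m n : nat).
Implicit Types (b : R) (p q : seq point).

Lemma near_affine_lt (z y z' y' b : R) : z - b * y < z' - b * y' ->
  \forall c \near b, z - c * y < z' - c * y'.
Proof.
move=> lt.
have cvg (u v : R) : u - c * v @[c --> b] --> u - b * v.
  by apply: cvgB; [exact: cvg_cst|apply: cvgM; [exact: cvg_id|exact: cvg_cst]].
have := cvgr_gt _ (cvgB (cvg z' y') (cvg z y)) (0 : R).
rewrite subr_gt0 => /(_ _ _ lt); apply: filterS => c /=.
by rewrite subr_gt0.
Qed.

(** If all maximisers at b had the same number of gaps, they would also have the
    same number of matches and hence stay tied for every penalty, while all the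
    other paths would stay strictly worse near b: the optimality region could
    not change at b. *)
Lemma critical_two_maximisers b : critical_penalties wx wy m n b ->
  exists p q, [/\ maximisers wx wy m n b p, maximisers wx wy m n b q
    & (gaps p < gaps q)%N].
Proof.
move=> [b0 crit]; apply: contrapT => none.
have same p q : maximisers wx wy m n b p -> maximisers wx wy m n b q ->
    gaps p = gaps q.
  move=> pM qM; case: (ltngtP (gaps p) (gaps q)) => // lt; case: none.
    by exists p, q.
  by exists q, p.
have [p [pM pmin]] := min_gap_maximisers_neq0 (R := R) wx wy m n b.
have [pA pmax] := pM.
(* A score depends only on the pair (matches, gaps), which takes finitely many
   values: a single neighbourhood of b suits all paths. *)
pose N := (m + n).+1.
pose below (t : 'I_N * 'I_N) : set R := [set c |
  t.1%:R - b * t.2%:R < score wx wy b p ->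
  t.1%:R - c * t.2%:R < score wx wy c p].
have near_max : nbhs b [set c | forall t, below t c].
  apply: (@filter_forall _ _ below (nbhs b) _) => -[i j]; rewrite /below /=.
  have [lt|_] := boolP (i%:R - b * j%:R < score wx wy b p); last first.
    exact: filterE.
  by have := near_affine_lt lt; apply: filterS => c h _.
have : exists2 e : R, 0 < e & forall c, `|c - b| < e ->
    forall t, below t c.
  move: near_max; rewrite -nbhs_ballE => -[e /= e0 eP]; exists e => // c ce.
  by apply: eP; rewrite -ball_normE /= distrC.
case=> e e0 eP {near_max}.
(* Hence p remains a minimal-gap maximiser throughout the neighbourhood. *)
have inM c : `|c - b| < e -> min_gap_maximisers wx wy m n c p.
  move=> /eP {}eP.
  have dich q : admissible m n q ->
      score wx wy c q < score wx wy c p \/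
      gaps q = gaps p /\ score wx wy c q = score wx wy c p.
    move=> qA; have [lt|] := ltP (score wx wy b q) (score wx wy b p).
      left; exact: (eP (Ordinal (matches_le wx wy qA), Ordinal (gaps_le qA))).
    move=> le; right.
    have E : score wx wy b q = score wx wy b p.
      by apply: le_anti; rewrite le pmax.
    have g : gaps q = gaps p.
      by apply: same => //; split=> // q' q'A; rewrite E pmax.
    by split=> //; move: E; rewrite /score g => /addIr ->.
  split; first by split=> // q /dich[/ltW//|[_ ->]].
  move=> q [qA qmax]; have [|[-> //]] := dich _ qA.
  by rewrite ltNge qmax.
have [c [c' [_ _ ce c'e]]] := crit e e0.
by move=> /seteqP[sub _]; apply: (sub p); split; exact: inM.
Qed.

(** Adding up the two optimality inequalities gives (c - b)(gaps p - gaps q) >= 0;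
    the comparison of matches then follows from optimality of p. *)
Lemma maximisers_monotone b c p q : 0 < b -> b < c ->
  maximisers wx wy m n b p -> maximisers wx wy m n c q ->
  (gaps q <= gaps p)%N /\ (matches wx wy q <= matches wx wy p)%N.
Proof.
move=> b0 bc [pA pmax] [qA qmax].
have := pmax _ qA; have := qmax _ pA; rewrite /score => h1 h2.
have g : (gaps q)%:R <= (gaps p)%:R :> R by nra.
split; first by rewrite -(ler_nat R).
by rewrite -(ler_nat R); nra.
Qed.

(** No path has fewer gaps than q, so a path whose score reaches that of q must
    make up for its gaps with matches. *)
Lemma maximiser_counts b p q : 0 <= b -> (n <= m)%N ->
  maximisers wx wy m n b p -> admissible m n q -> gaps q = (m - n)%N ->
  (matches wx wy q <= matches wx wy p)%N.
Proof.
move=> b0 nm [pA pmax] qA qg; rewrite -(ler_nat R).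
have [h _ _] := admissible_counts wx wy pA.
have : (gaps q)%:R <= (gaps p)%:R :> R by rewrite ler_nat qg; lia.
by have := pmax _ qA; rewrite /score; nra.
Qed.

(** The edges (dg, dm) attached to the critical penalties have distinct slopes and
    occupy, in the coordinate gaps + matches, disjoint subintervals of an
    interval that starts at m - r = (m - n) + (n - r) and has length 3 r. *)
Lemma num_critical_le (u r : nat) : (r <= n)%N -> (n <= m)%N ->
  (n - r <= greedy wx wy (m - r))%N ->
  (u * num_critical R wx wy m n <= u ^ 3 + 3 * r)%N.
Proof.
move=> rn nm gr.
have [q0 [q0A q0g q0m]] := path_few_mismatches rn nm gr.
have ex b : exists pq : seq point * seq point,
    critical_penalties wx wy m n b ->
    [/\ maximisers wx wy m n b pq.1, maximisers wx wy m n b pq.2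
      & (gaps pq.1 < gaps pq.2)%N].
  have [/critical_two_maximisers[p [q ?]]|?] :=
    pselect (critical_penalties wx wy m n b); first by exists (p, q).
  by exists ([::], [::]).
have [f fP] := choice ex.
rewrite /num_critical; set X := fset_set _.
have inX b : b \in enum_fset X -> critical_penalties wx wy m n b.
  rewrite -[b \in _]/(b \in X) in_fset_set; last exact: finite_critical_penalties.
  by move/set_mem.
have uX : uniq (enum_fset X) by exact: fset_uniq.
(* Along the staircase both counts are monotone, so their sum locates an edge. *)
pose pos p := (gaps p + matches wx wy p)%N.
pose dg b := (gaps (f b).2 - gaps (f b).1)%N.
pose dm b := (matches wx wy (f b).2 - matches wx wy (f b).1)%N.
have slope b : b \in enum_fset X ->
    [/\ (0 < dg b)%N, (matches wx wy (f b).1 <= matches wx wy (f b).2)%N &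
        (dm b)%:R = b * (dg b)%:R].
  move=> /inX bc; have [b0 _] := bc.
  have [[pA pM] [qA qM] lt] := fP _ bc.
  have E : score wx wy b (f b).1 = score wx wy b (f b).2.
    by apply: le_anti; rewrite pM// qM.
  have le : (matches wx wy (f b).1 <= matches wx wy (f b).2)%N.
    rewrite -(ler_nat R); move: lt; rewrite -(ltr_nat R).
    by move: E; rewrite /score; nra.
  split=> //; first by rewrite /dg; lia.
  rewrite /dm /dg !natrB//; last exact: ltnW.
  by move: E; rewrite /score; lra.
have inj : {in enum_fset X &, injective (fun b => (dg b, dm b))}.
  move=> b c bX cX [eg em].
  have [b0 _ bE] := slope _ bX; have [_ _ cE] := slope _ cX.
  have g0 : (dg b)%:R != 0 :> R by rewrite pnatr_eq0 -lt0n.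
  by apply: (mulIf g0); rewrite -bE em cE eg.
apply: leq_trans (size_distinct_pairs u uX inj) _; rewrite leq_add2l.
have -> : (\sum_(b <- enum_fset X) (dg b + dm b) =
    \sum_(b <- enum_fset X) (pos (f b).2 - pos (f b).1))%N.
  apply: eq_big_seq => b bX; have [] := slope _ bX.
  by rewrite /dg /dm /pos; lia.
apply: (sum_disjoint_intervals (b := (m - r)%N)) => //.
  move=> b /inX bc; have [b0 _] := bc; have [pM qM _] := fP _ bc.
  have := maximiser_counts (ltW b0) nm pM q0A q0g.
  have := maximiser_counts (ltW b0) nm qM q0A q0g.
  have [pA _] := pM; have [qA _] := qM.
  have [? ? ?] := admissible_counts wx wy pA.
  have [? ? ?] := admissible_counts wx wy qA.
  by rewrite /pos; lia.
have mono b c : b \in enum_fset X -> c \in enum_fset X -> b < c ->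
    (pos (f c).2 <= pos (f b).1)%N.
  move=> /inX bc /inX cc lt; have [b0 _] := bc.
  have [pM _ _] := fP _ bc; have [_ qM _] := fP _ cc.
  by have [? ?] := maximisers_monotone b0 lt pM qM; rewrite leq_add.
by move=> b c bX cX; rewrite neq_lt => /orP[/mono ->|/mono ->]//; rewrite orbT.
Qed.

End CriticalPenalties.

(** * Moments of the greedy matching *)

Lemma big_tuple_cons (A : finType) (V : nmodType) (m : nat)
    (F : m.+1.-tuple A -> V) :
  \sum_t F t = \sum_c \sum_(t : m.-tuple A) F [tuple of c :: t].
Proof.
rewrite pair_bigA /=.
rewrite (reindex (fun p : A * m.-tuple A => [tuple of p.1 :: p.2])) //=.
exists (fun t : m.+1.-tuple A => (thead t, [tuple of behead t])).
  by move=> [c t] _; congr (_, _); apply: val_inj.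
by move=> t _; rewrite [RHS]tuple_eta; apply: val_inj.
Qed.

Section GreedyMoments.
Context {A : finType} {R : realType} (a0 : A).
Local Notation k := #|A|.
Implicit Types (wy : nat -> A).

(** Peeling off the first letter of the long word, rather than the last one, lets
    sums over words be computed by induction: the remaining word meets either
    the same short word or its shift. *)
Lemma greedyS_head (wx wy : nat -> A) (i : nat) :
  let b : nat := (wx 0%N == wy 0%N) in
  greedy wx wy i.+1 = (b + greedy (wx \o S) (fun j => wy (b + j)%N) i)%N.
Proof.
move=> b; elim: i => [|i IH]; first by rewrite /= addn0 add0n.
by rewrite [LHS]/= -[(greedy _ _ i + _)%N]/(greedy wx wy i.+1) IH /= addnA.
Qed.

(** The difference between the number of greedy matches and its mean i/k, scaled
    by k. It is a sum of i independent centred jumps, which are k - 1 with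
    probability 1/k and -1 otherwise. *)
Definition deviation wy (i : nat) (m : nat) (t : m.-tuple A) : R :=
  k%:R * (greedy (nth a0 t) wy i)%:R - i%:R.

Let jump (b : bool) : R := k%:R * b%:R - 1.

Lemma deviation_cons wy (i m : nat) (c : A) (t : m.-tuple A) :
  deviation wy i.+1 [tuple of c :: t] =
  jump (c == wy 0%N) + deviation (fun j => wy ((c == wy 0%N) + j)%N) i t.
Proof.
rewrite /deviation greedyS_head natrD -[i.+1]addn1 natrD /jump /=.
rewrite -[_ \o _]/(nth a0 t); lra.
Qed.

Lemma sum_jump (c0 : A) : \sum_(c : A) jump (c == c0) = 0.
Proof.
rewrite (bigD1 c0)//= eqxx (eq_bigr (fun=> -1)); last first.
  by move=> c /negbTE ->; rewrite /jump mulr0 add0r.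
rewrite sumr_const cardC1 /jump mulr1.
have : (0 < k)%N by apply/card_gt0P; exists a0.
by case: k => // p _; rewrite /= -[p.+1]addn1 natrD mulNrn; lra.
Qed.

Lemma sum_jump_sq (c0 : A) :
  \sum_(c : A) jump (c == c0) ^+ 2 = k%:R * (k%:R - 1).
Proof.
rewrite (bigD1 c0)//= eqxx (eq_bigr (fun=> 1)); last first.
  by move=> c /negbTE ->; rewrite /jump mulr0 add0r sqrrN expr1n.
rewrite sumr_const cardC1 /jump mulr1.
have : (0 < k)%N by apply/card_gt0P; exists a0.
by case: k => // p _; rewrite /= -[p.+1]addn1 natrD; nra.
Qed.

Lemma sum_deviation wy (i m : nat) : (i <= m)%N ->
  \sum_(t : m.-tuple A) deviation wy i t = 0.
Proof.
elim: i m wy => [|i IH] m wy.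
  by rewrite big1// => t _; rewrite /deviation mulr0 subr0.
case: m => // m im; rewrite big_tuple_cons.
under eq_bigr => c _.
  under eq_bigr => t _ do rewrite deviation_cons.
  rewrite big_split /= IH// addr0 sumr_const.
  over.
by rewrite sumrMnl sum_jump mul0rn.
Qed.

(** The variance: the cross terms vanish because the deviation is centred
    whatever the short word, hence after a match as well as after a mismatch. *)
Lemma sum_deviation_sq wy (i m : nat) : (i <= m)%N ->
  \sum_(t : m.-tuple A) deviation wy i t ^+ 2 =
  k%:R ^+ m * (i%:R * (k%:R - 1)).
Proof.
elim: i m wy => [|i IH] m wy.
  by rewrite big1 ?mul0r ?mulr0// => t _; rewrite /deviation mulr0 subr0 expr0n.
case: m => // m im; rewrite big_tuple_cons.
under eq_bigr => c _.
  under eq_bigr => t _ do rewrite deviation_cons sqrrD.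
  rewrite 2!big_split /= IH// [X in _ + X + _]sumrMnl -[X in X *+ 2]mulr_sumr.
  rewrite sum_deviation// mulr0 mul0rn addr0 sumr_const card_tuple.
  rewrite -[X in X + _]mulr_natl.
  over.
rewrite big_split /= -[X in X + _]mulr_sumr sum_jump_sq sumr_const -[i.+1]addn1 natrD natrX.
by rewrite exprS -[_ *+ k]mulr_natl; ring.
Qed.

Lemma deviation_chebyshev wy (i m : nat) (d : R) : (i <= m)%N -> 0 <= d ->
  d ^+ 2 * \sum_(t : m.-tuple A) (deviation wy i t <= - d)%R%:R <=
  k%:R ^+ m * (i%:R * (k%:R - 1)).
Proof.
move=> im d0; rewrite -(sum_deviation_sq wy im) mulr_sumr ler_sum// => t _.
have [le|_] := boolP (_ <= - d); last by rewrite mulr0 sqr_ge0.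
by rewrite mulr1; nra.
Qed.

(** By telescoping, since 1/(y+1)^2 <= 1/y - 1/(y+1). *)
Lemma sum_inverse_squares (s : R) (N : nat) : 0 < s ->
  \sum_(j < N) ((s + j%:R + 1) ^+ 2)^-1 <= s^-1 - (s + N%:R)^-1.
Proof.
move=> s0; elim: N => [|N IH]; first by rewrite big_ord0 addr0 subrr.
rewrite big_ord_recr /=; set y : R := s + N%:R.
have y0 : 0 < y by rewrite ltr_pwDl.
have -> : s + N.+1%:R = y + 1 by rewrite -addn1 natrD addrA.
suff : ((y + 1) ^+ 2)^-1 <= y^-1 - (y + 1)^-1 by move: IH; rewrite -/y; lra.
have -> : y^-1 - (y + 1)^-1 = (y * (y + 1))^-1 by field; lra.
by rewrite lef_pV2 ?posrE; nra.
Qed.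

(** The inner sum counts the r for which the greedy matching is late, that is,
    still has more than r letters of wy to match when r letters of wx are left.
    A late r forces a deviation below -((k-1) r - z), which is at most
    -(k-1) r / 2 when r >= 4 z / k >= 2 z / (k-1); by Chebyshev its frequency is
    then at most 8 n / r^2. Summing this over r beyond 4 z / k + sqrt n costs at
    most 8 sqrt n, and the smaller r are counted with frequency 1. *)
Lemma mean_late_matches (m n : nat) (z : R) wy : (2 <= k)%N -> (0 < n)%N ->
  0 <= z -> (m%:R <= k%:R * n%:R :> R) -> k%:R * n%:R - z <= m%:R ->
  \sum_(t : m.-tuple A) \sum_(r < n)
      ((greedy (nth a0 t) wy (m - r) < n - r)%N)%:R <=
  k%:R ^+ m * (4 * z / k%:R + 9 * Num.sqrt n%:R + 2) :> R.
Proof.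
move=> k2 n0 z0 mk km.
have k2R : 2 <= k%:R :> R by rewrite ler_nat.
have km0 : 0 <= k%:R ^+ m :> R by rewrite exprn_ge0.
have n0R : 0 < n%:R :> R by rewrite ltr0n.
rewrite exchange_big /=.
set c := fun r : nat => \sum_(t : m.-tuple A)
  ((greedy (nth a0 t) wy (m - r) < n - r)%N)%:R : R.
have c0 r : 0 <= c r by rewrite sumr_ge0.
have c1 r : c r <= k%:R ^+ m.
  rewrite -natrX -card_tuple -sum1_card natr_sum ler_sum// => t _.
  by case: (_ < _)%N.
have csmall r : 4 * z / k%:R <= r%:R -> (0 < r)%N ->
    c r <= k%:R ^+ m * (8 * n%:R) * (r%:R ^+ 2)^-1.
  move=> zr r0; rewrite ler_pdivrMr in zr; last by lra.
  have r0R : 0 < r%:R :> R by rewrite ltr0n.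
  rewrite ler_pdivlMr ?exprn_gt0//.
  have [nr|rn] := leqP n r.
    rewrite /c big1 ?mul0r.
      by rewrite mulr_ge0// mulr_ge0// ler0n.
    by move=> t _; move/eqP: nr => ->.
  have h0 : 0 <= (k%:R - 1) * r%:R / 2 :> R by nra.
  have := deviation_chebyshev wy (leq_subr r m) h0.
  set Q := \sum_t _ => cheb.
  have cQ : c r <= Q.
    apply: ler_sum => t _.
    have [lt|//] := boolP (greedy _ _ _ < _)%N; rewrite ler_nat lt0b.
    have ltR : (greedy (nth a0 t) wy (m - r))%:R + 1 <= n%:R - r%:R :> R.
      by rewrite -natrB ?(ltnW rn)// -[1]/(1%:R) -natrD addn1 ler_nat.
    have mr : m%:R - r%:R <= (m - r)%:R :> R.
      by rewrite lerBlDr -natrD ler_nat; lia.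
    by rewrite /deviation; nra.
  have mr : (m - r)%:R <= k%:R * n%:R :> R.
    by apply: le_trans mk; rewrite ler_nat leq_subr.
  have mr0 : 0 <= (m - r)%:R :> R by [].
  have Q0 : 0 <= Q by rewrite sumr_ge0.
  have {}cheb : (k%:R - 1) * (r%:R ^+ 2 * Q) <= 4 * (k%:R ^+ m * (m - r)%:R).
    by rewrite -(ler_pM2l (_ : 0 < k%:R - 1)) ?subr_gt0//; nra.
  have k1 : 0 < k%:R - 1 :> R by lra.
  rewrite -(ler_pM2l k1); apply: le_trans (_ : (k%:R - 1) * (r%:R ^+ 2 * Q) <= _).
    by rewrite ler_pM2l// mulrC ler_wpM2l// sqr_ge0.
  apply: le_trans cheb _; set K := _ ^+ m in km0 *.
  have : (m - r)%:R <= 2 * ((k%:R - 1) * n%:R) :> R.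
    by apply: le_trans mr _; nra.
  by move=> /(ler_wpM2l km0); lra.
set u : R := 4 * z / k%:R + Num.sqrt n%:R.
have z4 : 0 <= 4 * z / k%:R by rewrite divr_ge0 ?mulr_ge0.
have sq0 : 0 < Num.sqrt n%:R :> R by rewrite sqrtr_gt0.
have u0 : 0 <= u by rewrite /u; lra.
have /andP[su us] := truncn_itv u0.
set s := (Num.truncn u).+1 in us; have s0 : 0 < s%:R :> R by rewrite ltr0n.
have su1 : s%:R <= u + 1 by rewrite /s -addn1 natrD lerD2r.
have usum : \sum_(r < n) c r <= \sum_(r < s.+1 + n) c r.
  by rewrite addnC big_split_ord /= lerDl sumr_ge0.
apply: le_trans usum _; rewrite big_split_ord /=.
have head : \sum_(r < s.+1) c r <= k%:R ^+ m * (u + 2).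
  apply: (@le_trans _ _ (\sum_(r < s.+1) k%:R ^+ m)); first exact: ler_sum.
  rewrite sumr_const card_ord -[X in X <= _]mulr_natr ler_wpM2l//.
  by rewrite -addn1 natrD; lra.
have tail : \sum_(j < n) c (s.+1 + j)%N <= k%:R ^+ m * (8 * Num.sqrt n%:R).
  apply: (@le_trans _ _ (\sum_(j < n)
      k%:R ^+ m * (8 * n%:R) * ((s%:R + j%:R + 1) ^+ 2)^-1)).
    apply: ler_sum => j _.
    have -> : s%:R + j%:R + 1 = (s.+1 + j)%:R :> R.
      by rewrite -addn1 !natrD; lra.
    apply: csmall => //; rewrite natrD -addn1 natrD.
    have : 0 <= j%:R :> R by [].
    by move: us; rewrite /u; lra.
  rewrite -mulr_sumr -mulrA ler_wpM2l// -mulrA ler_pM2l//.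
  apply: (@le_trans _ _ (n%:R * s%:R^-1)).
    rewrite ler_wpM2l//; apply: le_trans (sum_inverse_squares n s0) _.
    by rewrite gerBl invr_ge0 addr_ge0.
  rewrite ler_pdivrMr// -{1}(sqr_sqrtr (ltW n0R)) expr2 ler_pM2l//.
  by move: us; rewrite /u; lra.
move: head tail; rewrite /u => head tail; apply: le_trans (lerD head tail) _.
by rewrite -mulrDr ler_wpM2l//; lra.
Qed.

End GreedyMoments.

(** * Expectations as averages over finite words *)

Section FiniteDependence.
Context {A : finType} {R : realType} (wx wy wx' wy' : nat -> A).

Lemma matches_ext (m n : nat) (pi : seq point) : admissible m n pi ->
  (forall i, (i < m)%N -> wx i = wx' i) ->
  (forall j, (j < n)%N -> wy j = wy' j) ->
  matches wx wy pi = matches wx' wy' pi.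
Proof.
elim/last_ind: pi m n => [//|pi q IH] m n.
rewrite /admissible rcons_path last_rcons => /andP[/andP[pP lq] /eqP qE] hx hy.
rewrite !matches_rcons; move: lq; rewrite {}qE {q}.
case lE : (last _ _) => [i j] lq.
have [im jn] : (i <= m /\ j <= n)%N.
  by move: lq; rewrite /diagonal /straight !xpair_eqE /=; lia.
rewrite (IH i j); first last.
- by move=> j' j'j; apply: hy; apply: leq_trans jn.
- by move=> i' i'i; apply: hx; apply: leq_trans im.
- by rewrite /admissible pP lE eqxx.
congr addn; congr nat_of_bool.
rewrite /diagonal xpair_eqE /=; case: eqP => //= mE; case: eqP => //= nE.
by rewrite /env /= hx ?hy// ?mE ?nE.
Qed.

Lemma num_critical_ext (m n : nat) :
  (forall i, (i < m)%N -> wx i = wx' i) ->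
  (forall j, (j < n)%N -> wy j = wy' j) ->
  num_critical R wx wy m n = num_critical R wx' wy' m n.
Proof.
move=> hx hy.
have E : @maximisers A R wx wy m n = @maximisers A R wx' wy' m n.
  apply/funext => b; apply/seteqP; split=> p [pA pmax]; split=> // q qA.
    rewrite /score -!(matches_ext _ hx hy)//; exact: pmax.
  rewrite /score !(matches_ext _ hx hy)//; exact: pmax.
by rewrite /num_critical /critical_penalties /different_regions
  /min_gap_maximisers E.
Qed.

End FiniteDependence.

Section ExpectationOverWords.
Context d (T : measurableType d) (R : realType) (P : probability T R)
  (A : finType) (a0 : A) (etax etay : nat -> T -> A)
  (iid : independent_uniform_words P etax etay).

Let Z (i : nat + nat) := match i with inl k => etax k | inr k => etay k end.

(** The event that the two words start with s and t. *)
Let cell (s t : seq A) : set T :=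
  \bigcap_(i in [set` map inl (iota 0 (size s)) ++ map inr (iota 0 (size t))])
    Z i @^-1` [set match i with inl k => nth a0 s k | inr k => nth a0 t k end].

Lemma cellP (s t : seq A) w : cell s t w <->
  (forall i, (i < size s)%N -> etax i w = nth a0 s i) /\
  (forall j, (j < size t)%N -> etay j w = nth a0 t j).
Proof.
split=> [h|[hx hy]].
  split=> i ilt.
    apply: (h (inl i)); rewrite /= mem_cat map_f ?mem_iota//.
  by apply: (h (inr i)); rewrite /= mem_cat orbC map_f ?mem_iota.
move=> [i|j] /=; rewrite mem_cat => /orP[] /mapP[i'] //; rewrite mem_iota add0n.
  by move=> h [->]; exact: hx.
by move=> h [->]; exact: hy.
Qed.

Lemma measurable_cell (s t : seq A) : measurable (cell s t).
Proof.
have [mZ _ _] := iid.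
apply: fin_bigcap_measurable => [|i _]; first exact: finite_seq.
exact: mZ.
Qed.

Lemma prob_cell (s t : seq A) :
  P (cell s t) = (#|A|%:R^-1 ^+ (size s + size t))%:E.
Proof.
have [_ unif ind] := iid.
rewrite /cell (ind _ (fun i =>
  [set match i with inl k => nth a0 s k | inr k => nth a0 t k end])); last first.
  rewrite cat_uniq !map_inj_uniq ?iota_uniq//; try by move=> ? ? [].
  by rewrite andbT; apply/hasPn => _ /mapP[j _ ->]; apply/mapP => -[].
rewrite (eq_bigr (fun=> (#|A|%:R^-1)%:E)); last by move=> i _; exact: unif.
rewrite prodEFin big_const_seq count_predT size_cat !size_map !size_iota.
by rewrite iter_mulr_1.
Qed.

(** The initial segments of the two words take finitely many values, and each of
    them has probability k^-(m + n). *)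
Lemma expectation_words (m n : nat) (G : (nat -> A) -> (nat -> A) -> R) :
  (forall u v, 0 <= G u v) ->
  (forall u u' v v', (forall i, (i < m)%N -> u i = u' i) ->
    (forall j, (j < n)%N -> v j = v' j) -> G u v = G u' v') ->
  'E_P[fun w => G (etax ^~ w) (etay ^~ w)]%E =
  (#|A|%:R^-1 ^+ (m + n) *
    \sum_(t : n.-tuple A) \sum_(s : m.-tuple A) G (nth a0 s) (nth a0 t))%:E.
Proof.
move=> G0 Gext.
pose g (p : m.-tuple A * n.-tuple A) := G (nth a0 p.1) (nth a0 p.2).
have g0 p : 0 <= g p by exact: G0.
have decomp w : G (etax ^~ w) (etay ^~ w) =
    \sum_p g p * \1_(cell p.1 p.2) w.
  have word (l : nat) (f : nat -> A) :
      exists s : l.-tuple A, forall i, (i < l)%N -> nth a0 s i = f i.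
    exists [tuple f i | i < l] => i il.
    by rewrite -[i]/(val (Ordinal il)) -tnth_nth tnth_mktuple.
  have [s0 s0E] := word m (etax ^~ w); have [t0 t0E] := word n (etay ^~ w).
  rewrite (bigD1 (s0, t0))//= big1 => [|[s t] /= st].
    rewrite addr0 indicE mem_set ?mulr1.
      by apply: Gext => i il; rewrite /= ?s0E ?t0E.
    by apply/cellP; rewrite !size_tuple; split=> i il; rewrite ?s0E ?t0E.
  rewrite indicE memNset ?mulr0// => /cellP[]; rewrite !size_tuple => hx hy.
  move/eqP: st; apply; congr (_, _).
    by apply: eq_from_tnth => i; rewrite !(tnth_nth a0) s0E// hx.
  by apply: eq_from_tnth => i; rewrite !(tnth_nth a0) t0E// hy.
rewrite unlock.
under eq_integral => w _ do rewrite decomp -sumEFin.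
rewrite ge0_integral_sum//=; last 2 first.
- move=> p; apply/measurable_EFinP; apply: measurable_funM => //.
  by apply: measurable_indic; exact: measurable_cell.
- by move=> p w _; rewrite lee_fin mulr_ge0// indicE.
rewrite mulr_sumr; under [in RHS]eq_bigr do rewrite mulr_sumr.
rewrite exchange_big pair_bigA /= -sumEFin; apply: eq_bigr => p _.
under eq_integral => w _ do rewrite EFinM.
rewrite ge0_integralZl//=; last 2 first.
- apply/measurable_EFinP.
  by apply: measurable_indic; exact: measurable_cell.
- by rewrite lee_fin.
rewrite integral_indic ?setIT//; last exact: measurable_cell.
have pE := prob_cell p.1 p.2; rewrite !size_tuple in pE.
apply: etrans (congr1 (fun e => ((g p)%:E * e)%E) pE) _.
by rewrite -EFinM mulrC.
Qed.

End ExpectationOverWords.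

(** * The expected number of critical penalties *)

Section ExpectedNumber.
Context {A : finType} {R : realType} (wx wy : nat -> A) (m n : nat).

(** The least r for which the greedy matching is on time is the number of smaller
    r, which are all late; r = n is always on time. *)
Lemma num_critical_le_late (u : nat) : (n <= m)%N -> (0 < u)%N ->
  (num_critical R wx wy m n)%:R <= u%:R ^+ 2 + 3 / u%:R *
    \sum_(r < n) ((greedy wx wy (m - r) < n - r)%N)%:R :> R.
Proof.
move=> nm u0.
have ex : exists r, (n - r <= greedy wx wy (m - r))%N.
  by exists n; rewrite subnn.
case: (ex_minnP ex) => r good rmin.
have rn : (r <= n)%N by apply: rmin; rewrite subnn.
have : (r%:R : R) <= \sum_(r < n) ((greedy wx wy (m - r) < n - r)%N)%:R.
  have -> : r = (\sum_(i < n) (i < r))%N.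
    rewrite -[LHS](minn_idPr rn); elim: (n) => [|k IH].
      by rewrite big_ord0 min0n.
    by rewrite big_ord_recr /= -IH; lia.
  rewrite natr_sum ler_sum// => i _; rewrite ler_nat.
  have [ir|//] := boolP (i < r)%N; rewrite lt0b ltnNge.
  by apply/negP => /rmin; rewrite leqNgt ir.
set M := \sum_(_ < _) _ => rM.
have uR : 0 < u%:R :> R by rewrite ltr0n.
have := num_critical_le (R := R) u rn nm good.
rewrite -(ler_nat R) natrD natrX !natrM => le.
rewrite -(ler_pM2l uR) mulrDr -exprS mulrA mulrCA divff ?gt_eqF// mulr1.
by apply: le_trans le _; rewrite lerD2l ler_pM2l.
Qed.

End ExpectedNumber.

(** Averaging over the long word is enough: the bound is uniform in the short
    one. *)
Lemma expected_num_critical_le d (T : measurableType d) (R : realType)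
    (P : probability T R) (A : finType) (etax etay : nat -> T -> A)
    (m n u : nat) (z : R) :
  independent_uniform_words P etax etay -> (2 <= #|A|)%N ->
  (0 < n)%N -> (n <= m)%N -> (0 < u)%N -> 0 <= z ->
  m%:R <= #|A|%:R * n%:R :> R -> #|A|%:R * n%:R - z <= m%:R ->
  ('E_P[fun w => (num_critical R (etax ^~ w) (etay ^~ w) m n)%:R] <=
   (u%:R ^+ 2 + 3 / u%:R *
     (4 * z / #|A|%:R + 9 * Num.sqrt n%:R + 2))%:E)%E.
Proof.
move=> iid k2 n0 nm u0 z0 mk km.
have /card_gt0P[a0 _] : (0 < #|A|)%N by exact: leq_trans k2.
rewrite (expectation_words a0 iid (m := m) (n := n)
  (G := fun u v => (num_critical R u v m n)%:R)) => [||v v' w w' vE wE];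
  [|by []|by rewrite (num_critical_ext vE wE)].
have kR : 0 < #|A|%:R :> R by rewrite ltr0n (leq_trans _ k2).
have km0 l : 0 < #|A|%:R ^+ l :> R by rewrite exprn_gt0.
rewrite lee_fin exprVn mulrC ler_pdivrMr// exprD.
set E := (X in _ <= X * _).
have inner (t : n.-tuple A) : \sum_(s : m.-tuple A)
    (num_critical R (nth a0 s) (nth a0 t) m n)%:R <= #|A|%:R ^+ m * E.
  pose late (s : m.-tuple A) : R := \sum_(r < n)
    ((greedy (nth a0 s) (nth a0 t) (m - r) < n - r)%N)%:R.
  apply: (@le_trans _ _ (\sum_s (u%:R ^+ 2 + 3 / u%:R * late s))).
    by apply: ler_sum => s _; exact: num_critical_le_late.
  rewrite big_split /= sumr_const card_tuple -mulr_sumr.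
  rewrite -[X in X + _]mulr_natl natrX /E mulrDr lerD2l.
  rewrite [leRHS]mulrCA ler_wpM2l ?divr_ge0//.
  exact: mean_late_matches.
apply: (@le_trans _ _ (\sum_(t : n.-tuple A) #|A|%:R ^+ m * E)).
  exact: ler_sum.
rewrite sumr_const card_tuple -[X in X <= _]mulr_natl natrX.
by rewrite mulrC -mulrA [E * _]mulrC mulrA [_ * E]mulrC mulrA.
Qed.

(** * Asymptotics *)

Section Asymptotics.
Context {R : realType}.

Lemma limn_esup_le_near (v : nat -> \bar R) (l : \bar R) :
  (\forall n \near \oo, (v n <= l)%E) -> (limn_esup v <= l)%E.
Proof.
move=> vl; rewrite /limn_esup limf_esupE.
apply: (@le_trans _ _ (ereal_sup (v @` [set n | (v n <= l)%E]))).
  by apply: ereal_inf_lbound; exists [set n | (v n <= l)%E].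
by apply: ge_ereal_sup => _ [n /= nl <-].
Qed.

Lemma near_le_powR (e K : R) : 0 < e -> \forall n \near \oo, K <= n%:R `^ e.
Proof.
move=> e0; have [K0|K0] := leP K 0.
  by near=> n; apply: le_trans K0 _; exact: powR_ge0.
near=> n.
have Kn : K `^ e^-1 <= n%:R by near: n; exact: nbhs_infty_ger.
have KE : (K `^ e^-1) `^ e = K.
  by rewrite -powRrM mulVf ?lt0r_neq0// powRr1// ltW.
rewrite -KE.
by apply: ge0_ler_powR; rewrite ?nnegrE ?powR_ge0 ?ler0n ?(ltW e0).
Unshelve. all: by end_near. Qed.

(** The fluctuations of order sqrt n of the greedy matching are negligible: in the
    regime a <= 1/2 this is what the logarithm of g(n) is for. *)
Lemma near_le_growth (a K : R) : 0 < K ->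
  \forall n \near \oo, K * Num.sqrt n%:R <= growth a n.
Proof.
move=> K0; rewrite /growth; have [a2|a2] := leP a 2^-1.
  near=> n.
  have Kn : expR (K ^+ 2) <= n%:R by near: n; exact: nbhs_infty_ger.
  have n0 : 0 < n%:R :> R by apply: lt_le_trans Kn; exact: expR_gt0.
  rewrite (sqrtrM _ (ltW n0)) [leRHS]mulrC ler_wpM2r ?sqrtr_ge0//.
  have KE : K = Num.sqrt (K ^+ 2) by rewrite sqrtr_sqr ger0_norm// ltW.
  rewrite KE ler_wsqrtr//.
  by rewrite -[leLHS]expRK ler_ln ?posrE ?expR_gt0.
have e0 : 0 < a - 2^-1 by rewrite subr_gt0.
near=> n.
have n0 : (0 < n)%N by near: n; exact: nbhs_infty_gt.
have n0R : 0 < n%:R :> R by rewrite ltr0n.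
have Kn : K <= n%:R `^ (a - 2^-1) by near: n; exact: near_le_powR.
rewrite -[a](subrK 2^-1) powRD; last by rewrite (lt0r_neq0 n0R) implybT.
by rewrite powR12_sqrt ?ler0n// ler_wpM2r ?sqrtr_ge0.
Unshelve. all: by end_near. Qed.

Lemma near_powR_le_growth (a : R) : \forall n \near \oo,
  n%:R `^ a <= growth a n.
Proof.
have near1 := near_le_growth a (ltr01 : 0 < 1 :> R); near=> n.
have n0 : (0 < n)%N by near: n; exact: nbhs_infty_gt.
have : 1 * Num.sqrt n%:R <= growth a n by near: n.
rewrite /growth; have [a2|//] := leP a 2^-1.
rewrite mul1r; apply: le_trans.
by rewrite -powR12_sqrt ?ler0n// ler_powR// ler1n.
Unshelve. all: by end_near. Qed.

(** The value u ~ (g/k)^(1/3) balances u^2 against M/u when M is of order g/k. *)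
Lemma optimal_threshold (g k : R) : 0 < k -> k <= g ->
  exists (u : nat) (t : R), [/\ 0 < t, t < u%:R, u%:R <= 2 * t,
    t ^+ 3 = g / k & g `^ (2 / 3) = k `^ (2 / 3) * t ^+ 2].
Proof.
move=> k0 kg; have g0 : 0 < g := lt_le_trans k0 kg.
have gk0 : 0 < g / k by rewrite divr_gt0.
pose t := (g / k) `^ 3^-1.
have t0 : 0 < t by rewrite powR_gt0.
have t1 : 1 <= t.
  suff : 1 `^ 3^-1 <= t by rewrite powR1.
  apply: ge0_ler_powR; rewrite ?nnegrE ?(ltW gk0)//.
  by rewrite ler_pdivlMr// mul1r.
exists (Num.truncn t).+1, t.
have /andP[ut tu] := truncn_itv (ltW t0); split=> //.
- rewrite -addn1 natrD mulr_natl mulr2n; exact: lerD.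
- by rewrite -powR_mulrn ?ltW// -powRrM mulVf ?pnatr_eq0// powRr1// ltW.
- have -> : t ^+ 2 = (g / k) `^ (2 / 3).
    by rewrite -powR_mulrn ?ltW// -powRrM [3^-1 * _]mulrC.
  by rewrite -powRM ?divr_ge0 ?ltW// [k * _]mulrC divfK ?lt0r_neq0.
Qed.

(** With p = n^a and s = sqrt n, the hypothesis 45 k s <= g absorbs everything but
    the leading terms: three times the bound on the mean of M is at most
    (12 (x p + 1) + 33 k s) / k <= (12 x g + g) / k = (1 + 12 x) t^3, whereas
    u^2 <= 4 t^2. *)
Lemma threshold_bound (k x p s g t u : R) :
  2 <= k -> 0 <= x -> 0 <= p -> 1 <= s -> p <= g -> 45 * k * s <= g ->
  0 < t -> t < u -> u <= 2 * t -> t ^+ 3 = g / k ->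
  u ^+ 2 + 3 / u * (4 * (x * p + 1) / k + 9 * s + 2) <= (5 + 12 * x) * t ^+ 2.
Proof.
move=> k2 x0 p0 s1 pg sg t0 tu ut t3.
have k0 : 0 < k by lra.
have u0 : 0 < u by lra.
set W := _ + _ + 2.
have xp0 : 0 <= x * p by rewrite mulr_ge0.
have W0 : 0 <= W by rewrite /W !addr_ge0// ?divr_ge0// ?mulr_ge0//; lra.
have Wg : 3 * W <= t ^+ 3 * (1 + 12 * x).
  rewrite t3 -(ler_pM2l k0).
  have -> : k * (3 * W) = 12 * (x * p + 1) + 27 * (k * s) + 6 * k.
    by rewrite /W; field; rewrite gt_eqF.
  have -> : k * (g / k * (1 + 12 * x)) = g + 12 * (x * g).
    by field; rewrite gt_eqF.
  have h1 : x * p <= x * g by rewrite ler_wpM2l.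
  have h2 : k <= k * s by rewrite ler_peMr// ltW.
  lra.
have Wu : 3 / u * W <= t ^+ 2 * (1 + 12 * x).
  rewrite mulrAC ler_pdivrMr//; apply: le_trans Wg _.
  rewrite exprSr -mulrA [t * _]mulrC mulrA ler_wpM2l//; last exact: ltW.
  by rewrite mulr_ge0 ?sqr_ge0//; lra.
have : u ^+ 2 <= 4 * t ^+ 2.
  have -> : 4 * t ^+ 2 = (2 * t) ^+ 2 by ring.
  by rewrite ler_sqr ?nnegrE; lra.
by move: Wu; lra.
Qed.

Lemma long_side_bounds (k : nat) (x a : R) (n : nat) :
  (2 <= k)%N -> 0 <= x -> x * n%:R `^ a <= n%:R ->
  [/\ (n <= long_side k x a n)%N,
      (long_side k x a n)%:R <= k%:R * n%:R :> R &
      k%:R * n%:R - (x * n%:R `^ a + 1) <= (long_side k x a n)%:R].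
Proof.
move=> k2 x0 xn; have k2R : 2 <= k%:R :> R by rewrite ler_nat.
have xp0 : 0 <= x * n%:R `^ a by rewrite mulr_ge0 ?powR_ge0.
have n0 : 0 <= n%:R :> R by [].
have kn : 2 * n%:R <= k%:R * n%:R :> R by rewrite ler_wpM2r.
have side0 : 0 <= k%:R * n%:R - x * n%:R `^ a by lra.
have /andP[le gt] := truncn_itv side0.
split; first by rewrite truncn_ge_nat//; lra.
  by apply: le_trans le _; lra.
by move: gt; rewrite -addn1 natrD /long_side; lra.
Qed.

End Asymptotics.

Theorem theorem2p8 (R : realType) (x : R) (hx : 0 < x) :
  exists C2 : nat -> R,
    (forall (A : finType), (2 <= #|A|)%N ->
      forall (d : measure_display) (T : measurableType d)
        (P : probability T R) (etax etay : nat -> T -> A),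
        independent_uniform_words P etax etay ->
      forall a : R, 0 < a < 1 ->
        (limn_esup (fun n : nat =>
           'E_P[fun w => (num_critical R (etax ^~ w) (etay ^~ w)
                            (long_side #|A| x a n) n)%:R]
           * ((growth a n `^ (2 / 3))^-1)%:E)
         <= (C2 #|A|)%:E)%E)
    /\ C2 k @[k --> \oo] --> (0 : R).
Proof.
have c0 : 0 < 5 + 12 * x by lra.
exists (fun k => (5 + 12 * x) / k%:R `^ (2 / 3)); split; last first.
  apply/cvgr0Pnorm_le => e e0; near=> k.
  have k0 : 0 < k%:R `^ (2 / 3) :> R.
    apply: lt_le_trans (_ : 1 <= _); first by [].
    by near: k; apply: near_le_powR; lra.
  have ek : (5 + 12 * x) / e <= k%:R `^ (2 / 3).
    by near: k; apply: near_le_powR; lra.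
  rewrite ger0_norm; last by rewrite divr_ge0 ?ltW.
  rewrite ler_pdivrMr//.
  by rewrite ler_pdivrMr// in ek; rewrite [leRHS]mulrC.
move=> A k2 d T P etax etay iid a /andP[a0 a1].
have k2R : 2 <= #|A|%:R :> R by rewrite ler_nat.
have k0 : 0 < #|A|%:R :> R by lra.
apply: limn_esup_le_near; near=> n.
have n1 : (0 < n)%N by near: n; exact: nbhs_infty_gt.
have sqrt1 : 1 <= Num.sqrt n%:R :> R.
  by rewrite -[leLHS]sqrtr1 ler_wsqrtr// ler1n.
have powg : n%:R `^ a <= growth a n by near: n; exact: near_powR_le_growth.
have sqrtg : 45 * #|A|%:R * Num.sqrt n%:R <= growth a n.
  by near: n; apply: near_le_growth; rewrite mulr_gt0.
have kg : #|A|%:R <= growth a n.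
  apply: le_trans sqrtg; rewrite mulrAC ler_peMl ?ltW//; lra.
have xn : x * n%:R `^ a <= n%:R.
  have : x <= n%:R `^ (1 - a) by near: n; apply: near_le_powR; lra.
  move=> /(ler_wpM2r (powR_ge0 n%:R a)); rewrite -powRD; last first.
    by rewrite pnatr_eq0 -lt0n n1 implybT.
  by rewrite subrK powRr1.
have [nm mk km] := long_side_bounds k2 (ltW hx) xn.
have [u [t [t0 tu ut t3 gpow]]] := optimal_threshold k0 kg.
have u0 : (0 < u)%N by rewrite -(ltr_nat R); exact: lt_trans tu.
have z0 : 0 <= x * n%:R `^ a + 1 by rewrite addr_ge0// mulr_ge0 ?powR_ge0// ltW.
have bound := expected_num_critical_le iid k2 n1 nm u0 z0 mk km.
have kp0 : 0 < #|A|%:R `^ (2 / 3) :> R by exact: powR_gt0.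
have gp0 : 0 < growth a n `^ (2 / 3) by rewrite powR_gt0// (lt_le_trans k0).
apply: le_trans (lee_wpmul2r _ bound) _; first by rewrite lee_fin invr_ge0 ltW.
rewrite -EFinM lee_fin ler_pdivrMr// gpow mulrA divfK ?lt0r_neq0//.
exact: (threshold_bound k2R (ltW hx) (powR_ge0 _ _) sqrt1 powg sqrtg).
Unshelve. all: by end_near. Qed.
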